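(* Let $\mathcal{H}$ be a complex Hilbert space, let $A\in\mathcal{B}(\mathcal{H})$ be positive semidefinite, and let $T\in\mathcal{B}_A(\mathcal{H})$. Then $$\begin{aligned} dw_A^2(T)\le\inf_{\lambda\in\mathbb{C}}\Big\{ &\Big(2\big\|Re(\lambda)\,Re_A(T)+Im(\lambda)\,Im_A(T)\big\|_A+\big\||T|_A^2-2Re_A(\overline{\lambda}T)\big\|_A\Big)^2\\ &+2\|Re_A(\overline{\lambda}T)\|_A-|\lambda|^2+w_A^2(T-\lambda I)\Big\}.\end{aligned}$$ In particular, $dw_A(T)\le\sqrt{w_A^2(T)+\|T\|_A^4}$.
   Context: $\mathcal{B}(\mathcal{H})$ is the algebra of bounded linear operators on the complex Hilbert space $\mathcal{H}$, with identity $I$. For a positive semidefinite $A\in\mathcal{B}(\mathcal{H})$, put $\langle x,y\rangle_A=\langle Ax,y\rangle$ and $\|x\|_A=\sqrt{\langle x,x\rangle_A}$. $\mathcal{B}_A(\mathcal{H})$ is the set of $T\in\mathcal{B}(\mathcal{H})$ admitting an $A$-adjoint, i.e. such that $AX=T^*A$ has a solution $X\in\mathcal{B}(\mathcal{H})$; then $T^{\sharp_A}$ denotes the unique solution with $\mathcal{R}(T^{\sharp_A})\subseteq\overline{\mathcal{R}(A)}$ ($\mathcal{R}$ denotes range). Every $T\in\mathcal{B}_A(\mathcal{H})$ is $A$-bounded, i.e. $\|Tx\|_A\le c\|x\|_A$ for all $x$ and some $c>0$. Write $|T|_A^2=T^{\sharp_A}T$, $Re_A(T)=\frac12(T+T^{\sharp_A})$,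 $Im_A(T)=\frac1{2\mathrm{i}}(T-T^{\sharp_A})$; $Re(\lambda)$, $Im(\lambda)$ are the real and imaginary parts of the scalar $\lambda$. For $A$-bounded $T$: $\|T\|_A=\sup\{\|Tx\|_A:\|x\|_A=1\}$, $w_A(T)=\sup\{|\langle Tx,x\rangle_A|:\|x\|_A=1\}$, and $dw_A(T)=\sup\{\sqrt{|\langle Tx,x\rangle_A|^2+\|Tx\|_A^4}:\|x\|_A=1\}$, where $x$ ranges over $\mathcal{H}$. $dw_A^2(T)$ means $(dw_A(T))^2$, and similarly for $w_A^2$. *)

(* Defs.v *)
From HB Require Import structures.
From mathcomp Require Import all_boot all_order all_algebra sesquilinear.
From mathcomp Require Import all_classical all_reals all_analysis.
From mathcomp Require Export complex.
Set Implicit Arguments.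
Unset Strict Implicit.
Unset Printing Implicit Defensive.
Import Order.TTheory GRing.Theory Num.Theory Num.Def.
Import numFieldNormedType.Exports.
Local Open Scope classical_set_scope.
Local Open Scope ring_scope.

(* A complex Hilbert space is a complete normed space H over R[i] with an inner
   product [dot], linear in its first argument, inducing the norm of H.
   That compatibility is a hypothesis of the theorem, not of the definitions. *)
Section semi_hilbertian.
Context {R : realType} {H : completeNormedModType R[i]}.
Variable dot : {dot H for conjC}.

Definition bounded_operator (T : H -> H) : Prop :=
  linear T /\ bounded_near T (nbhs (0 : H)).

(* In R[i], [0 <= z] says that z is real and nonnegative. *)
Definition positive_operator (T : H -> H) : Prop :=
  bounded_operator T /\ forall x, 0 <= dot (T x) x.

(* The Hilbert adjoint: the unique S below exists for every bounded T, by the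
   Riesz representation theorem (completeness of H). *)
Definition adjoint (T : H -> H) : H -> H :=
  xget (cst 0)
    [set S | bounded_operator S /\ forall x y, dot (T x) y = dot x (S y)].

Section with_A.
Variable A : H -> H.

Definition dotA (x y : H) : R[i] := dot (A x) y.

Definition normA (x : H) : R := Num.sqrt (complex.Re (dotA x x)).

Definition A_adjoint (T X : H -> H) : Prop :=
  bounded_operator X /\ A \o X = adjoint T \o A.

Definition BA : set (H -> H) :=
  [set T | bounded_operator T /\ exists X, A_adjoint T X].

(* For T in BA the reduced A-adjoint exists and is unique (project any
   A-adjoint of T onto the closure of the range of A). *)
Definition sharpA (T : H -> H) : H -> H :=
  xget (cst 0)
    [set X | A_adjoint T X /\ range X `<=` closure (range A)].

Definition abs2A (T : H -> H) : H -> H := sharpA T \o T.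

Definition ReA (T : H -> H) : H -> H := 2%:R^-1 *: (T + sharpA T).

Definition ImA (T : H -> H) : H -> H := (2%:R * 'i)^-1 *: (T - sharpA T).

Definition unit_sphereA : set H := [set x | normA x = 1].

(* The suprema below are real suprema; all the sets are bounded for operators
   in BA, and they are empty (with supremum 0) exactly when A = 0. *)
Definition opnormA (T : H -> H) : R :=
  sup [set normA (T x) | x in unit_sphereA].

Definition wA (T : H -> H) : R :=
  sup [set complex.Re `|dotA (T x) x| | x in unit_sphereA].

Definition dwA (T : H -> H) : R :=
  sup [set Num.sqrt ((complex.Re `|dotA (T x) x|) ^+ 2 + normA (T x) ^+ 4)
      | x in unit_sphereA].

Definition dw_bound (T : H -> H) (lambda : R[i]) : R :=
  (2 * opnormA ('Re lambda *: ReA T + 'Im lambda *: ImA T)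
     + opnormA (abs2A T - 2%:R *: ReA (lambda^* *: T))) ^+ 2
  + 2 * opnormA (ReA (lambda^* *: T)) - (complex.Re `|lambda|) ^+ 2
  + wA (T - lambda *: idfun) ^+ 2.

End with_A.
End semi_hilbertian.

(* Main.v *)
Require Import Defs.
From HB Require Import structures.
From mathcomp Require Import all_boot all_order all_algebra sesquilinear.
From mathcomp Require Import all_classical all_reals all_analysis.
From mathcomp Require Import complex ring lra.
Import Order.TTheory GRing.Theory Num.Theory Num.Def.
Import numFieldNormedType.Exports.
Local Open Scope classical_set_scope.
Local Open Scope ring_scope.
Set Implicit Arguments.
Unset Strict Implicit.
Unset Printing Implicit Defensive.

(* For [normA x = 1] put [t = <Tx, x>_A] and [p = Re (conj lambda * t)]. Both
   [Re(lambda) Re_A(T) + Im(lambda) Im_A(T)] and [Re_A(conj lambda T)] have real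
   part of numerical value [p] at [x], so [||Tx||_A^2 = <|T|_A^2 x, x>_A] splits
   as [<(|T|_A^2 - 2 Re_A(conj lambda T)) x, x>_A + 2 p], while
   [|t|^2 = |t - lambda|^2 + 2 p - |lambda|^2]. Bounding each numerical value by
   the corresponding seminorm or numerical radius gives the first inequality.
   The reduced adjoint is obtained by composing an A-adjoint with the orthogonal
   projection onto the closure of the range of [A], and T is A-bounded by a
   spectral-radius argument applied to [X \o T] for an A-adjoint [X] of [T].
   If [A = 0] the unit sphere is empty and the infimum runs over [- |lambda|^2],
   a set unbounded below, so [inf] takes its junk value 0, which equals [dwA]. *)

(** * Elementary inequalities over the reals *)

Lemma quadratic_ge0_bound (R : realType) (a b s : R) : 0 <= s -> 0 <= b ->
  (forall t, 0 <= a - 2 * t * s + t ^+ 2 * s * b) -> s <= a * b.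
Proof.
move=> s0 b0 H; have a0 : 0 <= a.
  by have := H 0; rewrite expr0n /= !(mulr0, mul0r) subr0 addr0.
(* For [b > 0] the minimiser [t = 1 / b] gives the claim; for [b = 0] the expression is affine in
   [t], which forces [s = 0]. *)
move: b0; rewrite le_eqVlt => /orP[/eqP b0|b0]; last first.
  have := H b^-1.
  have -> : a - 2 * b^-1 * s + b^-1 ^+ 2 * s * b = (a * b - s) / b.
    by field; rewrite gt_eqF.
  by rewrite pmulr_lge0 ?invr_gt0 // subr_ge0.
rewrite -b0 mulr0 leNgt; apply/negP => s_gt0.
(* This [t] is chosen to bring the affine expression down to [-1]. *)
have := H ((a + 1) / (2 * s)); rewrite -b0 mulr0 addr0.
have -> : a - 2 * ((a + 1) / (2 * s)) * s = -1 by field; rewrite gt_eqF.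
by rewrite oppr_ge0 lt_geF.
Qed.

Lemma bernoulli (R : realType) (h : R) n : 0 <= h -> 1 + n%:R * h <= (1 + h) ^+ n.
Proof.
move=> h0; elim: n => [|n IH]; first by rewrite mul0r addr0.
rewrite exprSr; apply: le_trans (ler_wpM2r _ IH); last by rewrite addr_ge0.
have n0 : 0 <= n%:R * h * h by rewrite !mulr_ge0.
by rewrite -natr1; nra.
Qed.

Lemma sup_nonneg (R : realType) (S : set R) : (forall x, S x -> 0 <= x) -> 0 <= sup S.
Proof.
move=> S0; have [[[x Sx] Sub]|nS] := pselect (has_sup S); last by rewrite sup_out.
exact: le_trans (S0 x Sx) (ub_le_sup Sub Sx).
Qed.

(** * The modulus of a complex number as a real number *)

Section modulus.
Context {R : realType}.
Implicit Types (z w : R[i]) (r : R).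

(** The norm on [R[i]] takes values in [R[i]]; this version lies in [R], where suprema and square
    roots are taken. *)
Definition cmod z : R := complex.Re `|z|.

Lemma norm_cmod z : `|z| = (cmod z)%:C%C.
Proof. by rewrite /cmod RRe_real ?normr_real. Qed.

Lemma cmodE z : cmod z = Num.sqrt (complex.Re z ^+ 2 + complex.Im z ^+ 2).
Proof. by rewrite /cmod normc_def. Qed.

Lemma sqr_cmod z : cmod z ^+ 2 = complex.Re z ^+ 2 + complex.Im z ^+ 2.
Proof. by rewrite cmodE sqr_sqrtr // addr_ge0 ?sqr_ge0. Qed.

Lemma cmod_ge0 z : 0 <= cmod z.
Proof. by rewrite cmodE sqrtr_ge0. Qed.

Lemma cmod_real r : cmod r%:C%C = `|r|.
Proof. by rewrite cmodE /= expr0n addr0 sqrtr_sqr. Qed.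

Lemma cmodD z w : cmod (z + w) <= cmod z + cmod w.
Proof. by rewrite -lecR rmorphD /= -!norm_cmod ler_normD. Qed.

Lemma cmod_eq0 z : cmod z = 0 -> z = 0.
Proof. by move=> z0; apply/normr0_eq0; rewrite norm_cmod z0. Qed.

Lemma Re_le_cmod z : `|complex.Re z| <= cmod z.
Proof. by rewrite -lecR -norm_cmod normc_ge_Re. Qed.

Lemma conjCE z : (z^*)%R = (z^*)%C.
Proof. by []. Qed.

Lemma conjCC r : ((r%:C%C)^*)%R = r%:C%C.
Proof. exact: conjc_real. Qed.

Lemma Re_conj z : complex.Re z^* = complex.Re z.
Proof. by case: z. Qed.

Lemma Re_realM r z : complex.Re (r%:C%C * z) = r * complex.Re z.
Proof. by case: z => a b /=; rewrite mul0r subr0. Qed.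

Lemma mulC_conj_cmod z : z * z^* = (cmod z ^+ 2)%:C%C.
Proof. by rewrite -normCK norm_cmod rmorphXn. Qed.

End modulus.

(** * Semi-inner products, Cauchy-Schwarz and the induced seminorm *)

Section semi_inner_product.
Context {R : realType} {V : lmodType R[i]}.

(** Null vectors are allowed, so that both [dot] and [dotA] are instances. *)
Definition semi_inner_product (B : V -> V -> R[i]) : Prop :=
  [/\ forall a x y z, B (a *: x + y) z = a * B x z + B y z,
      forall x y, B y x = (B x y)^* & forall x, 0 <= B x x].

Definition qform (B : V -> V -> R[i]) x : R := complex.Re (B x x).

Definition seminorm (B : V -> V -> R[i]) x : R := Num.sqrt (qform B x).

Variable B : V -> V -> R[i].
Hypothesis HB : semi_inner_product B.

Lemma sip_conj x y : B y x = (B x y)^*.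
Proof. by case: HB. Qed.

Lemma sipPl a x y z : B (a *: x + y) z = a * B x z + B y z.
Proof. by case: HB. Qed.

Lemma sipDl x y z : B (x + y) z = B x z + B y z.
Proof. by rewrite -[x]scale1r sipPl mul1r scale1r. Qed.

Lemma sip0l z : B 0 z = 0.
Proof. by have := sipDl 0 0 z; rewrite addr0 => /eqP; rewrite -subr_eq subrr => /eqP. Qed.

Lemma sipZl a x z : B (a *: x) z = a * B x z.
Proof. by rewrite -[a *: x]addr0 sipPl sip0l addr0. Qed.

Lemma sipNl x z : B (- x) z = - B x z.
Proof. by rewrite -scaleN1r sipZl mulN1r. Qed.

Lemma sipBl x y z : B (x - y) z = B x z - B y z.
Proof. by rewrite sipDl sipNl. Qed.

Lemma sipDr x y z : B z (x + y) = B z x + B z y.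
Proof. by rewrite sip_conj sipDl rmorphD /= -!sip_conj. Qed.

Lemma sipZr a x z : B z (a *: x) = a^* * B z x.
Proof. by rewrite sip_conj sipZl rmorphM /= -!sip_conj. Qed.

Lemma sipNr x z : B z (- x) = - B z x.
Proof. by rewrite sip_conj sipNl rmorphN /= -!sip_conj. Qed.

Lemma sipBr x y z : B z (x - y) = B z x - B z y.
Proof. by rewrite sipDr sipNr. Qed.

Lemma sip0r z : B z 0 = 0.
Proof. by rewrite sip_conj sip0l rmorph0. Qed.

Lemma qformE x : B x x = (qform B x)%:C%C.
Proof. by rewrite RRe_real // ger0_real //; case: HB. Qed.

Lemma qform_ge0 x : 0 <= qform B x.
Proof. by rewrite -lecR -qformE; case: HB. Qed.

Lemma sqr_seminorm x : seminorm B x ^+ 2 = qform B x.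
Proof. by rewrite sqr_sqrtr ?qform_ge0. Qed.

Lemma seminorm_ge0 x : 0 <= seminorm B x.
Proof. exact: sqrtr_ge0. Qed.

(** The multiple of [y] is taken along the phase of [B x y], which leaves a real quadratic in [t] of
    the shape required by [quadratic_ge0_bound]. *)
Lemma qformB_proj t x y :
  qform B (x - (t%:C%C * B x y) *: y) =
    qform B x - 2 * t * cmod (B x y) ^+ 2
    + t ^+ 2 * cmod (B x y) ^+ 2 * qform B y.
Proof.
apply: complexI; rewrite -qformE sipBl !sipBr !sipZl !sipZr.
rewrite (sip_conj x y) !rmorphM /= conjCC !qformE.
have E := mulC_conj_cmod (B x y); rewrite rmorphXn /= in E.
rewrite !(rmorphD, rmorphN, rmorphM, rmorphXn, rmorph1) /= -expr2 -E.
ring.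
Qed.

Lemma cauchy_schwarz_sqr x y : cmod (B x y) ^+ 2 <= qform B x * qform B y.
Proof.
apply: quadratic_ge0_bound; rewrite ?sqr_ge0 ?qform_ge0 // => t.
by rewrite -qformB_proj qform_ge0.
Qed.

Lemma cauchy_schwarz x y : cmod (B x y) <= seminorm B x * seminorm B y.
Proof.
rewrite -sqrtrM ?qform_ge0 // -[leLHS]ger0_norm ?cmod_ge0 // -sqrtr_sqr.
by rewrite ler_wsqrtr // cauchy_schwarz_sqr.
Qed.

Lemma qformD x y : qform B (x + y) = qform B x + 2 * complex.Re (B x y) + qform B y.
Proof.
rewrite /qform sipDl !sipDr !raddfD /= (sip_conj x y) Re_conj.
by ring.
Qed.

Lemma qformN x : qform B (- x) = qform B x.
Proof. by rewrite /qform sipNl sipNr opprK. Qed.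

Lemma seminormD x y : seminorm B (x + y) <= seminorm B x + seminorm B y.
Proof.
rewrite -[_ <= _](ler_pXn2r (ltn0Sn 1)) ?nnegrE ?addr_ge0 ?seminorm_ge0 //.
rewrite sqr_seminorm qformD sqrrD !sqr_seminorm.
have := le_trans (ler_norm _) (le_trans (Re_le_cmod (B x y)) (cauchy_schwarz x y)).
by lra.
Qed.

Lemma seminormZ a x : seminorm B (a *: x) = cmod a * seminorm B x.
Proof.
rewrite /seminorm -[cmod a]ger0_norm ?cmod_ge0 // -sqrtr_sqr -sqrtrM ?sqr_ge0 //.
congr Num.sqrt; apply: complexI.
rewrite -qformE sipZl sipZr qformE mulrA mulC_conj_cmod.
exact: esym (rmorphM (real_complex R) _ _).
Qed.

Lemma seminormN x : seminorm B (- x) = seminorm B x.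
Proof. by rewrite /seminorm qformN. Qed.

End semi_inner_product.

(** * Orthogonal projection onto closed subspaces and its consequences *)

Section projection.
Context {R : realType} {H : completeNormedModType R[i]}.
Variable B : H -> H -> R[i].
Hypothesis HB : semi_inner_product B.
Hypothesis norm_B : forall x : H, `|x| = (seminorm B x)%:C%C.

(** Near-minimisers of the distance from [x] to [M] are almost orthogonal to [M], hence close to
    each other; completeness gives their limit, where orthogonality becomes exact. *)
Lemma orthogonal_projection (M : set H) : closed M -> M 0 ->
    (forall a x y, M x -> M y -> M (a *: x + y)) ->
  forall x, exists2 p, M p & forall z, M z -> B (x - p) z = 0.
Proof.
move=> Mcl M0 Mlin x.
have MB u v : M u -> M v -> M (v - u).
  by move=> Mu Mv; rewrite addrC -scaleN1r; apply: Mlin.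
pose D := [set qform B (x - m) | m in M]; pose d := inf D.
have D_inf : has_inf D.
  by split; [exists (qform B (x - 0)), 0 | exists 0 => _ [m _ <-]; exact: qform_ge0].
have d_le m : M m -> d <= qform B (x - m).
  by move=> Mm; apply: ge_inf; [case: D_inf | exists m].
pose N (s : R) := [set m | M m /\ qform B (x - m) < d + s ^+ 2].
have N_ne (s : R) : 0 < s -> N s !=set0.
  move=> s_gt0; have [_ [m Mm <-] mlt] := inf_adherent (exprn_gt0 2 s_gt0) D_inf.
  by exists m.
(* Moving [m] within [M] along [z] cannot bring the squared distance below [d], so it lowers that of
   [m] by at most [s ^+ 2]. *)
have almost_orth s m z : N s m -> M z ->
    cmod (B (x - m) z) ^+ 2 <= s ^+ 2 * qform B z.
  move=> [Mm /ltW mlt] Mz; apply: quadratic_ge0_bound; rewrite ?sqr_ge0 ?qform_ge0//.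
  move=> t; have := d_le (m + (t%:C%C * B (x - m) z) *: z).
  rewrite opprD addrA (qformB_proj HB) [m + _]addrC => /(_ (Mlin _ _ _ Mz Mm)).
  by lra.
have N_close (s : R) m m' : 0 < s -> N s m -> N s m' -> seminorm B (m - m') <= 3 * s.
  move=> s0 Nm Nm'; have Mz : M (m' - m) by apply: MB; [case: Nm|case: Nm'].
  have := almost_orth _ _ _ Nm Mz.
  have := qformD HB (x - m) (- (m' - m)).
  rewrite (qformN HB) (sipNr HB) raddfN /= opprB addrA subrK.
  rewrite -(seminormN HB (m - m')) opprB -!(sqr_seminorm HB (m' - m)).
  set w := seminorm _ _; have w0 : 0 <= w by exact: seminorm_ge0.
  have := le_trans (ler_norm _) (Re_le_cmod (B (x - m) (m' - m))).
  set c := cmod _ => Rec Em cle.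
  have {}cle : c <= s * w.
    by rewrite -(ler_pXn2r (ltn0Sn 1)) ?nnegrE ?cmod_ge0 ?mulr_ge0 ?(ltW s0)// exprMn.
  have := d_le _ (proj1 Nm); case: Nm' => _; rewrite Em => h1 h2.
  (* This yields [w <= (1 + sqrt 2) * s], which is below [3 * s]. *)
  have {h1 h2} h : w ^+ 2 <= s ^+ 2 + 2 * (s * w) by nra.
  rewrite leNgt; apply/negP => ws; nra.
pose F := filter_from [set s : R | 0 < s] N.
have FF : ProperFilter F.
  apply: filter_from_proper; last by move=> s; exact: N_ne.
  apply: filter_from_filter; first by exists 1 => /=.
  move=> s t /= s0 t0; exists (Num.min s t); first by rewrite /= lt_min s0.
  have mono (a b : R) m : 0 < a -> a <= b -> N a m -> N b m.
    move=> a0 ab [Mm mlt]; split=> //; apply: lt_le_trans mlt _.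
    by rewrite lerD2l ler_sqr ?nnegrE // ltW// (lt_le_trans a0).
  have st0 : 0 < Num.min s t by rewrite lt_min s0.
  by move=> m Nm; split; apply: mono Nm; rewrite // ge_min lexx ?orbT.
have F_cauchy : cauchy F.
  apply: cauchy_exP => e; rewrite ltcE /= => /andP[/eqP Ime e0].
  (* A quarter of the radius suffices, as near-minimisers differ by at most three times the
     parameter. *)
  have [m Nm] := N_ne _ (divr_gt0 e0 (ltr0n _ 4 : 0 < 4%:R)).
  exists m; exists (complex.Re e / 4); first by rewrite /= divr_gt0.
  move=> m' Nm'; rewrite -ball_normE /= norm_B ltcE /= Ime eqxx /=.
  by apply: le_lt_trans (N_close _ _ _ _ Nm Nm') _; rewrite ?divr_gt0 //; lra.
have [p Fp] : exists p : H, F --> p.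
  exists (lim F); exact: (cauchy_cvg F F_cauchy).
have Mp : M p.
  rewrite (closure_id M).1 // => U /Fp FU.
  have [|m [Mm Um]] := @filter_ex _ F _ (M `&` U); last by exists m.
  by apply: filterI => //; exists 1 => //= m [].
exists p => // z Mz; apply: cmod_eq0; apply/eqP; rewrite eq_le cmod_ge0 andbT.
suff le_eta eta : 0 < eta -> cmod (B (x - p) z) <= eta * (2 * seminorm B z).
  apply/ler_addgt0Pr => e e0; rewrite add0r.
  have z0 : 0 <= 2 * seminorm B z by rewrite mulr_ge0 ?seminorm_ge0.
  (* Adding 1 keeps the divisor positive when [z] has seminorm 0. *)
  have z1 : 0 < 2 * seminorm B z + 1 by rewrite ltr_wpDl.
  apply: le_trans (le_eta _ (divr_gt0 e0 z1)) _.
  by rewrite mulrAC -mulrA ler_piMr ?(ltW e0)// ler_pdivrMr // mul1r lerDl.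
move=> eta0.
have [|m [Nm]] := @filter_ex _ F _ (N eta `&` ball p eta%:C%C).
  by apply: filterI; [exists eta | apply: Fp; apply: nbhsx_ballx; rewrite ltcR].
rewrite -ball_normE /= norm_B ltcR => pm.
(* The first difference is almost orthogonal to [z]; the second is small because [m] is near the
   limit [p]. *)
have -> : x - p = (x - m) - (p - m) by rewrite opprB addrA subrK.
rewrite (sipBl HB) -(sipNl HB); apply: le_trans (cmodD _ _) _.
have -> : eta * (2 * seminorm B z) = eta * seminorm B z + eta * seminorm B z by ring.
rewrite lerD //.
  rewrite -(ler_pXn2r (ltn0Sn 1)) ?nnegrE ?cmod_ge0 ?mulr_ge0 ?seminorm_ge0 ?(ltW eta0)//.
  by rewrite exprMn sqr_seminorm // almost_orth.
apply: le_trans (cauchy_schwarz HB _ _) _; rewrite (seminormN HB).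
by rewrite ler_wpM2r ?seminorm_ge0 ?ltW.
Qed.

(** Balls of [H] have radii in [R[i]]; this replaces them by real radii. *)
Lemma closure_seminormP (M : set H) p :
  closure M p <-> forall e : R, 0 < e -> exists2 m, M m & seminorm B (p - m) < e.
Proof.
split=> [Mp e e0 | Mp U /nbhs_ballP[e /=]].
  have [|m [Mm]] := Mp (ball p e%:C%C); first by apply: nbhsx_ballx; rewrite ltcR.
  by rewrite -ball_normE /= norm_B ltcR => pm; exists m.
rewrite ltcE /= => /andP[/eqP Ime e0 eU]; have [m Mm pm] := Mp _ e0.
by exists m; split=> //; apply: eU; rewrite -ball_normE /= norm_B ltcE /= Ime eqxx.
Qed.

Lemma closure_subspace (M : set H) :
    (forall a x y, M x -> M y -> M (a *: x + y)) ->
  forall a x y, closure M x -> closure M y -> closure M (a *: x + y).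
Proof.
move=> Mlin a x y /closure_seminormP Mx /closure_seminormP My.
apply/closure_seminormP => e e0.
have a1 : 0 < 2 * (cmod a + 1) by rewrite mulr_gt0 // ltr_wpDl ?cmod_ge0.
have [u Mu xu] := Mx _ (divr_gt0 e0 a1).
have [v Mv yv] := My _ (divr_gt0 e0 (ltr0n R 2 : 0 < 2%:R)).
exists (a *: u + v); first exact: Mlin.
have -> : a *: x + y - (a *: u + v) = a *: (x - u) + (y - v).
  by rewrite scalerBr opprD addrACA.
apply: le_lt_trans (seminormD HB _ _) _; rewrite (seminormZ HB).
rewrite [e](splitr) ler_ltD //.
move: xu; rewrite ltr_pdivlMr // => xu.
have := seminorm_ge0 B (x - u); have := cmod_ge0 a; nra.
Qed.

(** * Nondegeneracy, Riesz representation and existence of adjoints *)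

Lemma seminorm_eq0 x : seminorm B x = 0 -> x = 0.
Proof. by move=> x0; apply: normr0_eq0; rewrite norm_B x0. Qed.

Lemma sip_injr s t : (forall x, B x s = B x t) -> s = t.
Proof.
move=> st; apply/eqP; rewrite -subr_eq0; apply/eqP/seminorm_eq0.
by rewrite /seminorm /qform (sipBr HB) st subrr sqrtr0.
Qed.

Lemma sip_injl s t : (forall x, B s x = B t x) -> s = t.
Proof. by move=> st; apply: sip_injr => x; rewrite !(sip_conj HB _ x) st. Qed.

(** If [f] is nonzero, the component [u] of some vector orthogonal to the closed kernel of [f] spans
    the representing direction. *)
Lemma riesz (f : H -> R[i]) (c : R) :
    (forall a x y, f (a *: x + y) = a * f x + f y) ->
    (forall x, cmod (f x) <= c * seminorm B x) ->
  exists s, forall x, f x = B x s.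
Proof.
move=> flin fle.
have f0 : f 0 = 0 by have := flin (-1) 0 0; rewrite scaler0 addr0 mulN1r addNr.
have fZ a x : f (a *: x) = a * f x by rewrite -[a *: x]addr0 flin f0 addr0.
have [[x0 fx0]|f_eq0] := pselect (exists x, f x <> 0); last first.
  exists 0 => x; rewrite (sip0r HB); apply: contrapT => fx.
  by apply: f_eq0; exists x.
pose M := [set x | f x = 0].
have fB x y : f (x - y) = f x - f y.
  by rewrite addrC -scaleN1r flin mulN1r addrC.
have Mcl : closed M.
  move=> p /closure_seminormP Mp; apply: cmod_eq0; apply/eqP.
  rewrite eq_le cmod_ge0 andbT; apply/ler_addgt0Pr => e e0; rewrite add0r.
  have c1 : 0 < `|c| + 1 by rewrite ltr_wpDl.
  have [m Mm pm] := Mp _ (divr_gt0 e0 c1).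
  have := fle (p - m); rewrite fB Mm subr0 => /le_trans; apply.
  move: pm; rewrite ltr_pdivlMr // => pm.
  have := ler_norm c; have := seminorm_ge0 B (p - m); nra.
have Mlin a x y : M x -> M y -> M (a *: x + y).
  by rewrite /M /= flin => -> ->; rewrite mulr0 addr0.
have [p Mp p_orth] := orthogonal_projection Mcl f0 Mlin x0.
set u := x0 - p in p_orth; have fu : f u <> 0 by rewrite fB Mp subr0.
have Bu : B u u != 0.
  apply/eqP => Bu; apply: fu; rewrite -f0; congr f; apply: seminorm_eq0.
  by rewrite /seminorm /qform Bu sqrtr0.
exists ((f u / B u u)^* *: u) => x; rewrite (sipZr HB) conjCK.
(* This combination lies in the kernel of [f], so it is orthogonal to [u]; solving for [f x] gives
   the formula. *)
have := p_orth (f u *: x + (- f x) *: u).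
rewrite /M /= flin fZ mulNr mulrC subrr => /(_ erefl).
rewrite (sip_conj HB _ u) => /(congr1 (fun z => z^*)); rewrite conjCK rmorph0.
rewrite (sipDl HB) !(sipZl HB) mulNr => /eqP; rewrite subr_eq0 => /eqP E.
by rewrite mulrAC E mulfK.
Qed.

Lemma bounded_operatorP (T : H -> H) : bounded_operator T <->
  linear T /\ exists2 c : R, 0 <= c & forall x, seminorm B (T x) <= c * seminorm B x.
Proof.
split=> -[Tlin].
  pose f : {linear H -> H} := HB.pack T (GRing.isLinear.Build _ _ _ _ T Tlin).
  move=> /(linear_boundedP f) [c [cR cle]]; split=> //.
  (* The bound is available for every real strictly above [c]; the absolute value makes the chosen
     one nonnegative. *)
  exists (`|complex.Re c| + 1); first by rewrite addr_ge0.
  move=> x; rewrite -lecR rmorphM /= -!norm_B; apply: cle.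
  rewrite -(RRe_real cR) ltcR; apply: le_lt_trans (ler_norm _) _.
  by rewrite ltrDl.
move=> [c c0 Tle]; split=> //.
pose f : {linear H -> H} := HB.pack T (GRing.isLinear.Build _ _ _ _ T Tlin).
apply/(linear_boundedP f); exists c%:C%C; split; first by apply/complex_realP; exists c.
move=> r cr x; apply: le_trans (ler_wpM2r (normr_ge0 _) (ltW cr)).
by rewrite /f /= !norm_B -[leRHS](rmorphM (real_complex R)) lecR.
Qed.

(** Riesz represents each functional [B (T x) y] of [x]. The bound on [S] follows from
    [B (S y) (S y) = B (T (S y)) y] by cancelling one factor [seminorm B (S y)]. *)
Lemma adjoint_exists (T : H -> H) : bounded_operator T ->
  exists S, bounded_operator S /\ forall x y, B (T x) y = B x (S y).
Proof.
move=> /bounded_operatorP[Tlin [c c0 Tle]].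
have repr y : exists s, forall x, B (T x) y = B x s.
  apply: (@riesz _ (c * seminorm B y)) => [a x z|x].
    by rewrite Tlin (sipPl HB).
  apply: le_trans (cauchy_schwarz HB _ _) _.
  by rewrite mulrAC ler_wpM2r ?seminorm_ge0.
have [S SE] := choice repr; exists S; split=> //; apply/bounded_operatorP; split.
  move=> a x y; apply: sip_injr => z.
  by rewrite (sipDr HB) (sipZr HB) -!SE (sipDr HB) (sipZr HB).
exists c => // y; have [->|Sy] := eqVneq (seminorm B (S y)) 0.
  by rewrite mulr_ge0 ?seminorm_ge0.
have Sy0 : 0 < seminorm B (S y) by rewrite lt_def Sy seminorm_ge0.
rewrite -(ler_pM2r Sy0) -expr2 (sqr_seminorm HB) /qform -SE.
apply: le_trans (le_trans (ler_norm _) (Re_le_cmod _)) _.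
apply: le_trans (cauchy_schwarz HB _ _) _.
by rewrite mulrAC ler_wpM2r ?seminorm_ge0.
Qed.

Lemma projection_operator (M : set H) : closed M -> M 0 ->
    (forall a x y, M x -> M y -> M (a *: x + y)) ->
  exists P, [/\ bounded_operator P, forall x, M (P x) &
    forall x z, M z -> B (x - P x) z = 0].
Proof.
move=> Mcl M0 Mlin.
have proj x : exists p, M p /\ forall z, M z -> B (x - p) z = 0.
  by have [p] := orthogonal_projection Mcl M0 Mlin x; exists p.
have [P PE] := choice proj; exists P; split; try by move=> x; case: (PE x).
have MP x : M (P x) by case: (PE x).
have P_orth x z : M z -> B (x - P x) z = 0 by case: (PE x) => _; apply.
apply/bounded_operatorP; split.
  move=> a x y; apply/eqP; rewrite -subr_eq0; apply/eqP/seminorm_eq0.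
  (* The defect of linearity lies in [M], yet it is also a combination of residuals orthogonal to
     [M]; so it is orthogonal to itself. *)
  set w := _ - _; rewrite /seminorm /qform.
  have Mw : M w.
    by rewrite /w [_ - _]addrC -scaleN1r; apply: (Mlin); [apply: (Mlin)|]; exact: MP.
  suff -> : B w w = 0 by rewrite sqrtr0.
  have {1}-> : w = a *: (x - P x) + (y - P y) - (a *: x + y - P (a *: x + y)).
    by rewrite /w scalerBr addrACA -opprD opprB [RHS]addrC subrKA.
  by rewrite (sipBl HB) (sipPl HB) !P_orth // mulr0 addr0 subr0.
exists 1 => // x; rewrite mul1r -(ler_pXn2r (ltn0Sn 1)) ?nnegrE ?seminorm_ge0 //.
(* Pythagoras for [x = (x - P x) + P x] shows that [P] is a contraction. *)
rewrite !(sqr_seminorm HB) -{2}[x](subrK (P x)) (qformD HB) P_orth //.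
by rewrite mulr0 addr0 lerDr (qform_ge0 HB).
Qed.

End projection.

(** * Seminorm bounds for symmetric operators by iteration *)

Section power_trick.
Context {R : realType} {V : lmodType R[i]}.
Variables B Q : V -> V -> R[i].
Hypothesis HQ : semi_inner_product Q.

(* Krein: iterating [Q (W ^ k x) (W ^ k x) = Q (W ^ 2k x) x] along [k = 2 ^ n]
   leaves only the spectral-radius contribution of [W] for [B]. *)
Lemma sym_seminorm_bound (W : V -> V) (c M : R) : 0 < M ->
    (forall x, seminorm Q x <= c * seminorm B x) ->
    (forall x, seminorm B (W x) <= M * seminorm B x) ->
    (forall x y, Q (W x) y = Q x (W y)) ->
  forall x, seminorm Q (W x) <= M * seminorm Q x.
Proof.
move=> M0 Qc WM Wsym x; pose q k := seminorm Q (iter k W x).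
have Witer k y z : Q (iter k W y) z = Q y (iter k W z).
  by elim: k z => //= k IH z; rewrite Wsym IH -iterS -iterSr.
have q_ge0 k : 0 <= q k by exact: seminorm_ge0.
have q_double k : q k ^+ 2 <= q (k + k)%N * q 0%N.
  rewrite (sqr_seminorm HQ) /qform Witer -iterD -Witer.
  apply: le_trans (le_trans (ler_norm _) (Re_le_cmod _)) _.
  exact: cauchy_schwarz.
rewrite -[W x]/(iter 1 W x) -[x in _ * seminorm Q x]/(iter 0 W x) -!/(q _).
have [q0|q0] := eqVneq (q 0%N) 0.
  have := q_double 1%N; rewrite q0 mulr0 => q1.
  by rewrite mulr0 -(ler_pXn2r (ltn0Sn 1)) ?nnegrE // expr0n.
have {}q0 : 0 < q 0%N by rewrite lt_def q0 q_ge0.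
pose r := q 1%N / q 0%N; have r0 : 0 <= r by rewrite divr_ge0.
rewrite -ler_pdivrMr // -/r leNgt; apply/negP => Mr.
(* If the ratio [r] exceeds [M], repeated doubling makes [q] grow at least like [r ^+ k] along
   [k = 2 ^ n], against the upper bound in [M ^+ k]. *)
have q_lower n : q 0%N * r ^+ (2 ^ n) <= q (2 ^ n)%N.
  elim: n => [|n IH]; first by rewrite expn0 expr1 /r mulrC divfK ?gt_eqF.
  rewrite expnS mul2n -addnn -(ler_pM2r q0); apply: le_trans (q_double _).
  rewrite exprD.
  have -> : q 0%N * (r ^+ (2 ^ n) * r ^+ (2 ^ n)) * q 0%N
          = (q 0%N * r ^+ (2 ^ n)) ^+ 2 by ring.
  by rewrite ler_pXn2r // nnegrE // mulr_ge0 // exprn_ge0.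
have q_upper k : q k <= c * seminorm B x * M ^+ k.
  (* For [c < 0] the left side is at most 0 and the right side at least 0. *)
  apply: le_trans (Qc _) _; have [c0|c0] := leP 0 c; last first.
    have : 0 <= c * seminorm B x by exact: le_trans (seminorm_ge0 _ _) (Qc _).
    rewrite nmulr_rge0 // => sx; apply: (@le_trans _ _ 0).
      by rewrite nmulr_rle0 // seminorm_ge0.
    by rewrite mulr_ge0 ?exprn_ge0 ?(ltW M0) // nmulr_rge0.
  rewrite -mulrA ler_wpM2l //; elim: k => [|k IH]; first by rewrite mulr1.
  apply: le_trans (WM _) _; rewrite exprS mulrCA.
  by rewrite ler_wpM2l // ltW.
pose h := r / M - 1; have h0 : 0 < h by rewrite subr_gt0 ltr_pdivlMr // mul1r.
pose D := c * seminorm B x / q 0%N.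
(* The two growth bounds confine [(r / M) ^+ (2 ^ n)] to [D]; Bernoulli makes it exceed any
   bound. *)
have bound n : 1 + n%:R * h <= D.
  apply: le_trans (bernoulli n (ltW h0)) _; rewrite addrC subrK.
  have rM : 1 <= r / M by rewrite ler_pdivlMr // mul1r ltW.
  apply: le_trans (ler_weXn2l rM (ltnW (ltn_expl n (ltnSn 1)))) _.
  rewrite expr_div_n ler_pdivrMr ?exprn_gt0 // -(ler_pM2l q0).
  apply: le_trans (le_trans (q_lower n) (q_upper _)) _.
  by rewrite mulrA /D [q 0%N * _]mulrC divfK ?gt_eqF.
have [n Dn] : exists n : nat, D / h < n%:R.
  by exists (Num.truncn (D / h)).+1; rewrite truncnS_gt.
have := bound n; rewrite leNgt => /negP; apply.
by rewrite ltr_pdivrMr // in Dn; apply: lt_trans Dn _; rewrite ltrDr.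
Qed.

End power_trick.

(** * Bounded operators and adjoints on the Hilbert space *)

Section A_operators.
Context {R : realType} {H : completeNormedModType R[i]}.
Variable dot : {dot H for conjC}.
Hypothesis dot_norm : forall x : H, `|x| ^+ 2 = dot x x.

Lemma dot_semi_inner : semi_inner_product dot.
Proof.
split=> [a x y z|x y|x].
- by rewrite linearDl linearZl_LR.
- by rewrite hermC expr0 mul1r.
- by rewrite -dot_norm exprn_ge0.
Qed.
Let HB := dot_semi_inner.

Lemma norm_dot x : `|x| = (seminorm dot x)%:C%C.
Proof.
rewrite -(RRe_real (normr_real x)) /seminorm /qform -dot_norm; congr _%:C%C.
rewrite -{2}(RRe_real (normr_real x)) -rmorphXn /= sqrtr_sqr ger0_norm //.
by rewrite -ler0c RRe_real ?normr_real.
Qed.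

Let boundedP := bounded_operatorP norm_dot.

Lemma bounded_operatorZ a (U : H -> H) :
  bounded_operator U -> bounded_operator (a *: U).
Proof.
move=> /boundedP[Ulin [c c0 Ule]]; apply/boundedP; split.
  move=> b x y; rewrite -[LHS]/(a *: U (b *: x + y)).
  rewrite -[RHS]/(b *: (a *: U x) + a *: U y).
  by rewrite Ulin scalerDr !scalerA mulrC.
exists (cmod a * c); first by rewrite mulr_ge0 ?cmod_ge0.
move=> x; rewrite -[X in seminorm _ X]/(a *: U x) (seminormZ HB).
by rewrite -mulrA ler_wpM2l ?cmod_ge0.
Qed.

Lemma bounded_operator_comp (U W : H -> H) :
  bounded_operator U -> bounded_operator W -> bounded_operator (U \o W).
Proof.
move=> /boundedP[Ulin [c c0 Ule]] /boundedP[Wlin [d d0 Wle]]; apply/boundedP.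
split=> [a x y|]; first by rewrite /= Wlin Ulin.
exists (c * d) => [|x /=]; first by rewrite mulr_ge0.
by apply: le_trans (Ule _) _; rewrite -mulrA ler_wpM2l.
Qed.

Lemma adjointP (T : H -> H) : bounded_operator T ->
  bounded_operator (adjoint dot T) /\ forall x y, dot (T x) y = dot x (adjoint dot T y).
Proof. by move=> /(adjoint_exists HB norm_dot) /(xgetPex (cst 0)). Qed.

(** * The positive operator [A], its semi-inner product and reduced adjoints *)

Variable A : H -> H.
Hypothesis A_pos : positive_operator dot A.

Let A_lin : linear A. Proof. by case: A_pos => -[]. Qed.

(** Polarization: the quadratic form of [A] is real at [x + y] and at [x + 'i *: y], which gives the
    imaginary and real parts of the identity. *)
Lemma positive_selfadjoint x y : dot (A x) y = dot x (A y).
Proof.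
have Areal z : complex.Im (dot (A z) z) = 0 by apply: ger0_Im; case: A_pos.
have AD u v : A (u + v) = A u + A v by rewrite -[u]scale1r A_lin !scale1r.
have AZ a v : A (a *: v) = a *: A v.
  have A0 : A 0 = 0.
    by have := AD 0 0; rewrite addr0 => /eqP; rewrite -subr_eq subrr => /eqP.
  by rewrite -[a *: v]addr0 A_lin A0 addr0.
have := Areal (x + y); have := Areal (x + 'i *: y).
rewrite !AD AZ !(sipDl HB) !(sipDr HB) !(sipZl HB) !(sipZr HB) -complexiE.
rewrite (sip_conj HB (A y) x).
have := Areal x; have := Areal y.
case: (dot (A x) x) => a1 a2; case: (dot (A y) y) => b1 b2.
case: (dot (A x) y) => c1 c2; case: (dot (A y) x) => d1 d2 /= -> -> h1 h2.
by apply/eqP; rewrite eq_complex /=; apply/andP; split; apply/eqP; lra.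
Qed.

Lemma dotA_semi_inner : semi_inner_product (dotA dot A).
Proof.
split=> [a x y z|x y|x]; rewrite /dotA.
- by rewrite A_lin (sipPl HB).
- by rewrite positive_selfadjoint (sip_conj HB).
- by case: A_pos.
Qed.
Let HA := dotA_semi_inner.

(** Nondegeneracy of [dot] turns the operator equation into an identity between values of the form,
    the version used in all later computations. *)
Lemma A_adjointP (T X : H -> H) : bounded_operator T ->
  A_adjoint dot A T X <->
  bounded_operator X /\ forall x y, dotA dot A (T x) y = dotA dot A x (X y).
Proof.
move=> /adjointP[_ TE].
have E x y : dotA dot A (T x) y = dot x ((adjoint dot T \o A) y).
  by rewrite /dotA positive_selfadjoint TE.
have E' x y : dotA dot A x (X y) = dot x ((A \o X) y).
  by rewrite /dotA positive_selfadjoint.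
split=> -[Xb XE]; split=> //; first by move=> x y; rewrite E E' XE.
by apply/funext => y; apply: (sip_injr HB norm_dot) => x; rewrite -E -E' XE.
Qed.

(** With [P] the projection onto the closure of the range of [A], [P \o X] is again an A-adjoint,
    because [A x] is orthogonal to every [X y - P (X y)]. So [xget] chooses from a nonempty set. *)
Lemma sharpAP (T : H -> H) : BA dot A T ->
  bounded_operator (sharpA dot A T) /\
  forall x y, dotA dot A (T x) y = dotA dot A x (sharpA dot A T y).
Proof.
move=> [Tb [X /(A_adjointP _ Tb)[Xb XE]]].
have A0 : A 0 = 0 by have := A_lin (-1) 0 0; rewrite scaler0 addr0 scaleN1r addNr.
have [P [Pb PM PE]] : exists P : H -> H, [/\ bounded_operator P,
    forall x, closure (range A) (P x) &
    forall x z, closure (range A) z -> dot (x - P x) z = 0].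
  apply: (projection_operator HB norm_dot); first exact: closed_closure.
    by apply: subset_closure; exists 0.
  apply: (closure_subspace HB norm_dot) => a _ _ [x _ <-] [y _ <-].
  by exists (a *: x + y); rewrite ?A_lin.
have /(xgetPex (cst 0)) : [set X | A_adjoint dot A T X /\
    range X `<=` closure (range A)] !=set0.
  exists (P \o X); split; last by move=> _ [x _ <-]; exact: PM.
  apply/(A_adjointP _ Tb); split; first exact: bounded_operator_comp.
  move=> x y; rewrite XE; apply/eqP; rewrite -subr_eq0 -(sipBr HB).
  rewrite (sip_conj HB) /= PE ?rmorph0 //.
  by apply: subset_closure; exists x.
by case=> /(A_adjointP _ Tb).
Qed.

Lemma BA_scale a (T : H -> H) : BA dot A T -> BA dot A (a *: T).
Proof.
move=> TB; have [Sb SE] := sharpAP TB; case: TB => Tb _.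
have aTb := bounded_operatorZ a Tb.
split=> //; exists (a^* *: sharpA dot A T); apply/(A_adjointP _ aTb); split.
  exact: bounded_operatorZ.
move=> x y; rewrite -[(a *: T) x]/(a *: T x).
rewrite -[(a^* *: _) y]/(a^* *: sharpA dot A T y).
by rewrite (sipZl HA) (sipZr HA) conjCK SE.
Qed.

(** * Boundedness with respect to the seminorm of [A] *)

Definition A_bounded (U : H -> H) :=
  exists2 c : R, 0 <= c & forall x, normA dot A (U x) <= c * normA dot A x.

Lemma A_boundedD U W : A_bounded U -> A_bounded W -> A_bounded (U + W).
Proof.
move=> [c c0 Uc] [d d0 Wd]; exists (c + d); first exact: addr_ge0.
move=> x; apply: le_trans (seminormD HA _ _) _.
by rewrite mulrDl; apply: lerD; [exact: Uc | exact: Wd].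
Qed.

Lemma A_boundedZ a U : A_bounded U -> A_bounded (a *: U).
Proof.
move=> [c c0 Uc]; exists (cmod a * c); first by rewrite mulr_ge0 ?cmod_ge0.
move=> x; rewrite /normA -/(qform _ _) -/(seminorm _ _) (seminormZ HA).
by rewrite -mulrA ler_wpM2l ?cmod_ge0 //; exact: Uc.
Qed.

Lemma A_boundedB U W : A_bounded U -> A_bounded W -> A_bounded (U - W).
Proof.
by move=> Ub Wb; apply: A_boundedD => //; rewrite -scaleN1r; apply: A_boundedZ.
Qed.

Lemma A_bounded_comp U W : A_bounded U -> A_bounded W -> A_bounded (U \o W).
Proof.
move=> [c c0 Uc] [d d0 Wd]; exists (c * d) => [|x /=]; first exact: mulr_ge0.
by apply: le_trans (Uc _) _; rewrite -mulrA ler_wpM2l.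
Qed.

Lemma A_bounded_id : A_bounded idfun.
Proof. by exists 1 => // x; rewrite mul1r. Qed.

Lemma normA_le_norm : exists c : R, forall x, normA dot A x <= c * seminorm dot x.
Proof.
have [_ [c c0 Ac]] := (boundedP A).1 (proj1 A_pos).
exists (Num.sqrt c) => x; rewrite /normA -/(qform _ _).
rewrite -[seminorm dot x]ger0_norm ?seminorm_ge0 //.
rewrite -sqrtr_sqr -sqrtrM // ler_wsqrtr //.
apply: le_trans (le_trans (ler_norm _) (Re_le_cmod _)) _.
apply: le_trans (cauchy_schwarz HB _ _) _.
by rewrite expr2 mulrA ler_wpM2r ?seminorm_ge0.
Qed.

(** [X \o T] is symmetric for [dotA], so the iteration bound applies to it, with [M + 1] to have a
    positive constant. Then Cauchy-Schwarz bounds [dotA x (X (T x))], the square of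
    [normA (T x)]. *)
Lemma A_adjointable_bounded (T X : H -> H) :
    bounded_operator T -> bounded_operator X ->
    (forall x y, dotA dot A (T x) y = dotA dot A x (X y)) -> A_bounded T.
Proof.
move=> Tb Xb XE; have [c Ac] := normA_le_norm.
have [_ [M M0 WM]] := (boundedP (X \o T)).1 (bounded_operator_comp Xb Tb).
have W_le x : normA dot A (X (T x)) <= (M + 1) * normA dot A x.
  apply: (@sym_seminorm_bound _ _ _ _ HA (X \o T) _ (M + 1) _ Ac).
  - by rewrite ltr_wpDl.
  - move=> y; apply: le_trans (WM _) _; rewrite ler_wpM2r ?seminorm_ge0 //.
    by rewrite lerDl.
  - by move=> y z /=; rewrite -XE (sip_conj HA) -XE -(sip_conj HA).
exists (Num.sqrt (M + 1)) => // x.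
rewrite -(ler_pXn2r (ltn0Sn 1)) ?nnegrE ?mulr_ge0 ?sqrtr_ge0 ?seminorm_ge0 //.
rewrite [leLHS](sqr_seminorm HA) /qform XE exprMn (sqr_sqrtr (addr_ge0 M0 ler01)).
apply: le_trans (le_trans (ler_norm _) (Re_le_cmod _)) _.
apply: le_trans (cauchy_schwarz HA _ _) _.
rewrite mulrC [X in _ <= _ * X]expr2 mulrA ler_wpM2r ?seminorm_ge0 //.
exact: W_le.
Qed.

Lemma BA_bounded (T : H -> H) : BA dot A T -> A_bounded T.
Proof.
move=> TB; have [Sb SE] := sharpAP TB.
exact: A_adjointable_bounded (proj1 TB) Sb SE.
Qed.

(** By conjugate symmetry [T] is in turn an A-adjoint of its reduced adjoint. *)
Lemma sharpA_bounded (T : H -> H) : BA dot A T -> A_bounded (sharpA dot A T).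
Proof.
move=> TB; have [Sb SE] := sharpAP TB.
apply: (A_adjointable_bounded Sb (proj1 TB)) => x y.
by rewrite (sip_conj HA) -SE -(sip_conj HA).
Qed.

(** * Numerical values at unit vectors against the suprema *)

Lemma normA_le_opnorm U x : A_bounded U -> normA dot A x = 1 ->
  normA dot A (U x) <= opnormA dot A U.
Proof.
(* A-boundedness bounds the set of values above, so [sup] is not its default 0. *)
move=> [c c0 Uc] x1; apply: ub_le_sup; last by exists x.
by exists c => _ [y y1 <-]; rewrite (le_trans (Uc y)) // y1 mulr1.
Qed.

Lemma cmod_dotA_le U x : normA dot A x = 1 ->
  cmod (dotA dot A (U x) x) <= normA dot A (U x).
Proof.
move=> x1; have := cauchy_schwarz HA (U x) x.
by rewrite -[seminorm _ x]/(normA dot A x) x1 mulr1.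
Qed.

Lemma Re_dotA_le_opnorm U x : A_bounded U -> normA dot A x = 1 ->
  complex.Re (dotA dot A (U x) x) <= opnormA dot A U.
Proof.
move=> Ub x1; apply: le_trans (le_trans (ler_norm _) (Re_le_cmod _)) _.
exact: le_trans (cmod_dotA_le _ x1) (normA_le_opnorm Ub x1).
Qed.

Lemma cmod_dotA_le_w U x : A_bounded U -> normA dot A x = 1 ->
  cmod (dotA dot A (U x) x) <= wA dot A U.
Proof.
move=> [c c0 Uc] x1; apply: ub_le_sup; last by exists x.
exists c => _ [y y1 <-]; apply: le_trans (cmod_dotA_le _ y1) _.
by rewrite (le_trans (Uc y)) // y1 mulr1.
Qed.

(** Fixing both [lambda] and the unit vector leaves scalar identities in [t]; the supremum and
    infimum are taken afterwards. *)
Lemma dw_pointwise (T : H -> H) lambda x : BA dot A T -> normA dot A x = 1 ->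
  cmod (dotA dot A (T x) x) ^+ 2 + normA dot A (T x) ^+ 4 <= dw_bound dot A T lambda.
Proof.
move=> TB x1; have [Sb SE] := sharpAP TB.
pose U := lambda^* *: T; have UB : BA dot A U := BA_scale _ TB.
have [SUb SUE] := sharpAP UB.
have [Tbd Sbd] := (BA_bounded TB, sharpA_bounded TB).
have [Ubd SUbd] := (BA_bounded UB, sharpA_bounded UB).
set t := dotA dot A (T x) x.
have St : dotA dot A (sharpA dot A T x) x = t^* by rewrite (sip_conj HA) -SE.
have Ut : dotA dot A (U x) x = lambda^* * t by rewrite -(sipZl HA).
have SUt : dotA dot A (sharpA dot A U x) x = (lambda^* * t)^*.
  by rewrite (sip_conj HA) -SUE Ut.
have Tt : dotA dot A (sharpA dot A T (T x)) x = (normA dot A (T x) ^+ 2)%:C%C.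
  rewrite (sip_conj HA) -SE (qformE HA) conjCC.
  by rewrite -(sqr_seminorm HA).
pose p := complex.Re (lambda^* * t).
set K1 := 'Re lambda *: ReA dot A T + 'Im lambda *: ImA dot A T.
set K3 := ReA dot A U; set K2 := abs2A dot A T - 2%:R *: K3.
have ReAbd : A_bounded (ReA dot A T) by exact/A_boundedZ/A_boundedD.
have ImAbd : A_bounded (ImA dot A T) by exact/A_boundedZ/A_boundedB.
have K3bd : A_bounded K3 by exact/A_boundedZ/A_boundedD.
have K1bd : A_bounded K1 by apply: A_boundedD; exact: A_boundedZ.
have K2bd : A_bounded K2.
  by apply: A_boundedB; [exact: A_bounded_comp | exact: A_boundedZ].
have K3t : complex.Re (dotA dot A (K3 x) x) = p.
  rewrite -[K3 x]/(2%:R^-1 *: (U x + sharpA dot A U x)).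
  by rewrite (sipZl HA) (sipDl HA) Ut SUt conjCE addcJ mulKf ?pnatr_eq0.
(* [ReA T] and [ImA T] take the values [Re t] and [Im t] at [x], and
   [Re lambda * Re t + Im lambda * Im t] is the real part of [lambda^* * t]. *)
have K1t : complex.Re (dotA dot A (K1 x) x) = p.
  rewrite -[K1 x]/('Re lambda *: (2%:R^-1 *: (T x + sharpA dot A T x)) +
    'Im lambda *: ((2%:R * 'i)^-1 *: (T x - sharpA dot A T x))).
  rewrite (sipDl HA) !(sipZl HA) (sipBl HA) (sipDl HA) -/t St.
  rewrite conjCE addcJ subcJ -complexRe -complexIm complexiE mulrAC.
  rewrite !mulKf ?mulf_neq0 ?pnatr_eq0 ?neq0Ci // /p.
  by case: (lambda) (t) => a b [c d] /=; ring.
have K2t : complex.Re (dotA dot A (K2 x) x) = normA dot A (T x) ^+ 2 - 2 * p.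
  rewrite -[K2 x]/(sharpA dot A T (T x) - 2%:R *: K3 x).
  rewrite (sipBl HA) (sipZl HA) Tt raddfB /= -K3t.
  have -> : 2%:R = (2%:R)%:C%C :> R[i] by rewrite rmorph_nat.
  by rewrite Re_realM.
(* As [x] is a unit vector, [T - lambda *: idfun] has value [t - lambda], whose squared modulus is
   the left side. *)
have W : cmod t ^+ 2 - 2 * p + cmod lambda ^+ 2
    <= wA dot A (T - lambda *: idfun) ^+ 2.
  have Wbd : A_bounded (T - lambda *: idfun).
    by apply: A_boundedB => //; apply: A_boundedZ; exact: A_bounded_id.
  have := cmod_dotA_le_w Wbd x1; rewrite -[(T - _) x]/(T x - lambda *: x).
  rewrite (sipBl HA) (sipZl HA) (qformE HA x) -(sqr_seminorm HA).
  rewrite -[seminorm _ x]/(normA dot A x) x1 expr1n mulr1 -/t => w.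
  apply: (@le_trans _ _ (cmod (t - lambda) ^+ 2)); last first.
    by rewrite ler_pXn2r // nnegrE ?cmod_ge0 // (le_trans _ w) ?cmod_ge0.
  rewrite !sqr_cmod /p; case: (lambda) (t) => a b [c d] /=.
  by rewrite le_eqVlt; apply/orP; left; apply/eqP; ring.
have h1 := Re_dotA_le_opnorm K1bd x1; rewrite K1t in h1.
have h2 := Re_dotA_le_opnorm K2bd x1; rewrite K2t in h2.
have h3 := Re_dotA_le_opnorm K3bd x1; rewrite K3t in h3.
rewrite /dw_bound -/U -/K1 -/K3 -/K2 -/(cmod lambda).
(* Sum of [h2] and twice [h1]; the terms in [p] cancel. *)
have h4 : normA dot A (T x) ^+ 2 <= 2 * opnormA dot A K1 + opnormA dot A K2 by lra.
have : (normA dot A (T x) ^+ 2) ^+ 2 <= (2 * opnormA dot A K1 + opnormA dot A K2) ^+ 2.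
  by rewrite ler_pXn2r // nnegrE ?(le_trans _ h4) ?exprn_ge0 ?seminorm_ge0.
rewrite -exprM; lra.
Qed.

(** Without unit vectors, normalization shows that [normA] vanishes identically; Cauchy-Schwarz then
    kills every [dot (A x) y]. *)
Lemma unit_sphereA_nonempty : A <> cst 0 -> unit_sphereA dot A !=set0.
Proof.
move=> A0; apply: contrapT => noU; apply: A0; apply/funext => x /=.
have nA0 y : normA dot A y = 0.
  apply: contrapT => /eqP y0; apply: noU.
  exists ((normA dot A y)^-1%:C%C *: y); rewrite /unit_sphereA /=.
  rewrite -[LHS]/(seminorm _ _) (seminormZ HA) cmod_real.
  by rewrite ger0_norm ?invr_ge0 ?seminorm_ge0 // mulVf.
apply: (sip_injl HB norm_dot) => y; rewrite (sip0l HB); apply: cmod_eq0.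
apply/eqP; rewrite eq_le cmod_ge0 andbT.
apply: le_trans (cauchy_schwarz HA x y) _.
by rewrite -[seminorm _ x]/(normA dot A x) nA0 mul0r.
Qed.

Lemma unit_sphereA0 : A = cst 0 -> unit_sphereA dot A = set0.
Proof.
move=> A0; apply/seteqP; split=> x //=; rewrite /unit_sphereA /= /normA /dotA A0.
by rewrite (sip0l HB) sqrtr0 => /eqP; rewrite eq_sym oner_eq0.
Qed.

Lemma dwA_le (T : H -> H) (D : R) : 0 <= D ->
    (forall x, normA dot A x = 1 ->
      cmod (dotA dot A (T x) x) ^+ 2 + normA dot A (T x) ^+ 4 <= D) ->
  dwA dot A T <= Num.sqrt D.
Proof.
(* For [A = 0] the supremum is over the empty set and equals 0, so [0 <= D] is what gives the
   bound. *)
move=> D0 TD; have [A0|A0] := pselect (A = cst 0).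
  by rewrite /dwA unit_sphereA0 // image_set0 sup0 sqrtr_ge0.
have [x x1] := unit_sphereA_nonempty A0.
apply: ge_sup; first by eexists; exists x.
by move=> _ [y y1 <-]; rewrite ler_wsqrtr // TD.
Qed.

End A_operators.

(** * Both inequalities for the Davis-Wielandt radius, with the degenerate case [A = 0] *)

Theorem theorem2p21 (R : realType) (H : completeNormedModType R[i])
    (dot : {dot H for conjC})
    (dot_norm : forall x : H, `|x| ^+ 2 = dot x x)
    (A T : H -> H)
    (A_pos : positive_operator dot A)
    (T_BA : BA dot A T) :
  [/\ A <> cst 0 -> has_inf [set dw_bound dot A T lambda | lambda in setT],
      dwA dot A T ^+ 2 <= inf [set dw_bound dot A T lambda | lambda in setT]
    & dwA dot A T <= Num.sqrt (wA dot A T ^+ 2 + opnormA dot A T ^+ 4)].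
Proof.
have dwA_ge0 : 0 <= dwA dot A T.
  by apply: sup_nonneg => _ [x _ <-]; exact: sqrtr_ge0.
have bound_ne : [set dw_bound dot A T lambda | lambda in setT] !=set0.
  by exists (dw_bound dot A T 0), 0.
have dw_le lambda : A <> cst 0 -> dwA dot A T ^+ 2 <= dw_bound dot A T lambda.
  move=> A0; have pw x := dw_pointwise dot_norm A_pos lambda T_BA (x := x).
  have [x x1] := unit_sphereA_nonempty dot_norm A_pos A0.
  (* The term [- |lambda|^2] hides the sign of the bound; the pointwise inequality at a unit vector
     reveals it. *)
  have D0 : 0 <= dw_bound dot A T lambda.
    by apply: le_trans (pw x x1); rewrite addr_ge0 ?exprn_ge0 ?cmod_ge0 ?seminorm_ge0.
  rewrite -[leRHS]sqr_sqrtr // ler_pXn2r ?nnegrE ?sqrtr_ge0 //.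
  exact: dwA_le.
split.
- move=> A0; split=> //; exists (dwA dot A T ^+ 2) => _ [lambda _ <-].
  exact: dw_le.
- have [A0|A0] := pselect (A = cst 0); last first.
    by apply: lb_le_inf => // _ [lambda _ <-]; exact: dw_le.
  have noU := unit_sphereA0 dot_norm A0.
  have E lambda : dw_bound dot A T lambda = - cmod lambda ^+ 2.
    rewrite /dw_bound /opnormA /wA noU !image_set0 !sup0.
    by rewrite !(mulr0, addr0) expr0n /= add0r addr0.
  rewrite /dwA noU image_set0 sup0 expr0n /= inf_out //.
  (* A lower bound [m] would satisfy [m <= - (1 + |m|)^2], which is below [- |m|]. *)
  case=> _ [m mlb]; pose a := 1 + `|m|.
  have : m <= - a ^+ 2.
    by apply: mlb; exists a%:C%C => //; rewrite E cmod_real ger0_norm // addr_ge0.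
  have := ler_norm (- m); rewrite normrN /a => mm; have := normr_ge0 m; nra.
(* Here each summand is bounded directly by its own supremum, without passing through the choice
   [lambda = 0]. *)
- apply: dwA_le => //; first by rewrite addr_ge0 ?sqr_ge0 // (exprM _ 2 2) sqr_ge0.
  move=> x x1; have Tbd := BA_bounded dot_norm A_pos T_BA.
  have h1 := cmod_dotA_le_w dot_norm A_pos Tbd x1.
  have h2 := normA_le_opnorm Tbd x1.
  by rewrite lerD // ler_pXn2r // nnegrE ?cmod_ge0 ?seminorm_ge0
    ?(le_trans _ h1) ?(le_trans _ h2) ?cmod_ge0 ?seminorm_ge0.
Qed.
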